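(* Product hoops coincide, up to isomorphism, with the maximal filters of product algebras, seen as residuated lattices with the restricted operations. That is, an algebra $\mathbf S$ in the signature $(\cdot,\to,\wedge,\vee,1)$ is a product hoop if and only if there are a product algebra $\mathbf P$ and a maximal filter $F$ of $\mathbf P$ such that $\mathbf S$ is isomorphic to $F$ endowed with the restrictions of the operations $\cdot,\to,\wedge,\vee,1$ of $\mathbf P$.
   Context: A bounded commutative integral residuated lattice (BCIRL) is an algebra $\mathbf A=(A,\cdot,\to,\wedge,\vee,0,1)$ such that $(A,\cdot,1)$ is a commutative monoid, $(A,\wedge,\vee,0,1)$ is a bounded lattice with least element $0$ and greatest element $1$, and $x\cdot y\le z$ iff $y\le x\to z$. Put $\neg x=x\to 0$. A BL-algebra is a BCIRL satisfying $x\wedge y=x(x\to y)$ and $(x\to y)\vee(y\to x)=1$. A product algebra is a BL-algebra satisfying $\neg x\vee((x\to(x\cdot y))\to y)=1$. A product hoop is a $0$-free subreduct of a product algebra, i.e. an algebra isomorphic to a subset of some product algebra that contains $1$ and is closed under $\cdot,\to,\wedge,\vee$, with the restricted operations. A filter of a product algebra $\mathbf P$ is a nonempty subset closed under $\cdot$ and upward closed in the lattice order. Every filter is closed under $\cdot,\to,\wedge,\vee$ and contains $1$. A filter is proper if it is not all of $P$, and maximal if it is proper and not strictly contained in any proper filter. *)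

(* Defs.v *)
From HB Require Import structures.
From mathcomp Require Import all_boot all_order.
From mathcomp Require Import classical_sets functions.

Set Implicit Arguments.
Unset Strict Implicit.
Unset Printing Implicit Defensive.

Import Order.TTheory.
Local Open Scope classical_set_scope.
Local Open Scope order_scope.

Declare Scope residuated_scope.
Delimit Scope residuated_scope with RL.
Local Open Scope residuated_scope.

(* The constants 0 and 1 of the algebra are the bounds \bot and \top of the
   underlying bounded lattice; a one-element algebra is allowed. *)
HB.mixin Record TBLattice_isBCIRL d A of Order.TBLattice d A := {
  rmul : A -> A -> A;
  rimp : A -> A -> A;
  rmulA : associative rmul;
  rmulC : commutative rmul;
  rmul1x : left_id (\top : A) rmul;
  residuation : forall x y z : A, (rmul x y <= z) = (y <= rimp x z)
}.

#[short(type="bcirlType")]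
HB.structure Definition BCIRL d :=
  { A of Order.TBLattice d A & TBLattice_isBCIRL d A }.

Notation "x ⋅ y" := (rmul x y)
  (at level 40, left associativity) : residuated_scope.
Notation "x ⇒ y" := (rimp x y)
  (at level 55, right associativity) : residuated_scope.

Definition rneg d (A : bcirlType d) (x : A) : A := x ⇒ \bot.

HB.mixin Record BCIRL_isBL d A of BCIRL d A := {
  divisibility : forall x y : A, x `&` y = x ⋅ (x ⇒ y);
  prelinearity : forall x y : A, (x ⇒ y) `|` (y ⇒ x) = \top
}.

#[short(type="blAlgType")]
HB.structure Definition BLAlgebra d := { A of BCIRL d A & BCIRL_isBL d A }.

HB.mixin Record BL_isProduct d A of BLAlgebra d A := {
  product_axiom : forall x y : A, rneg x `|` ((x ⇒ x ⋅ y) ⇒ y) = \top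
}.

#[short(type="productAlgType")]
HB.structure Definition ProductAlgebra d :=
  { A of BLAlgebra d A & BL_isProduct d A }.

(* An arbitrary algebra in the 0-free signature: no axiom is imposed. *)
Record hoopAlg : Type := HoopAlg {
  hcar :> Type;
  hmul : hcar -> hcar -> hcar;
  himp : hcar -> hcar -> hcar;
  hmeet : hcar -> hcar -> hcar;
  hjoin : hcar -> hcar -> hcar;
  hone : hcar
}.

Definition subreduct d (P : bcirlType d) (X : set P) : Prop :=
  [/\ X \top,
      forall x y, X x -> X y -> X (x ⋅ y),
      forall x y, X x -> X y -> X (x ⇒ y),
      forall x y, X x -> X y -> X (x `&` y) &
      forall x y, X x -> X y -> X (x `|` y)].

(* S is isomorphic to X with the restricted operations: the isomorphism is
   given as a map into P that is a bijection from S onto X. *)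
Definition isomorphic_to_sub (S : hoopAlg) d (P : bcirlType d) (X : set P) :
    Prop :=
  exists f : S -> P,
    [/\ set_bij [set: S] X f,
        {morph f : x y / hmul x y >-> x ⋅ y},
        {morph f : x y / himp x y >-> x ⇒ y},
        {morph f : x y / hmeet x y >-> x `&` y} &
        {morph f : x y / hjoin x y >-> x `|` y} /\ f (hone S) = \top].

Definition product_hoop (S : hoopAlg) : Prop :=
  exists (d : Order.disp_t) (P : productAlgType d) (X : set P),
    subreduct X /\ isomorphic_to_sub S X.

Definition is_filter d (P : bcirlType d) (F : set P) : Prop :=
  [/\ F !=set0,
      forall x y, F x -> F y -> F (x ⋅ y) &
      forall x y, F x -> x <= y -> F y].

Definition proper_filter d (P : bcirlType d) (F : set P) : Prop :=
  is_filter F /\ F <> [set: P].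

Definition maximal_filter d (P : bcirlType d) (F : set P) : Prop :=
  proper_filter F /\ ~ exists2 G : set P, proper_filter G & F `<` G.

(* Main.v *)
Require Import Defs.
From HB Require Import structures.
From mathcomp Require Import all_boot all_order.
From mathcomp Require Import boolp classical_sets functions.

(** Let X be the subreduct of a product algebra P carrying the given hoop. Call
z in P a co-element of X when some e in X satisfies z ⋅ e = 0 and z ∨ e ∈ X;
let Z be the set of all of them. In P × 2 the set (X × {1}) ∪ (Z × {0}) is a
subalgebra, and X × {1} is a maximal filter in it: a filter containing also some
(z, 0) contains (z, 0) ⋅ (e, 1) = (0, 0). The closure properties rest on two
facts valid in P: z ⋅ e = 0 implies z = z ⋅ ¬e, and double negation is given by
the 0-free term ¬¬u = (u ⇒ u ⋅ u) ⇒ u, so that X is closed under it. *)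

Set Implicit Arguments.
Unset Strict Implicit.
Unset Printing Implicit Defensive.

Import Order.TTheory.
Local Open Scope classical_set_scope.
Local Open Scope order_scope.
Local Open Scope residuated_scope.

(** * Arithmetic of residuated lattices *)

Section ResiduatedLattice.
Context {d : Order.disp_t} {A : bcirlType d}.
Implicit Types x y z e : A.

Lemma rmulx1 x : x ⋅ \top = x.
Proof. by rewrite rmulC rmul1x. Qed.

Lemma rmulAC x y z : x ⋅ y ⋅ z = x ⋅ z ⋅ y.
Proof. by rewrite -rmulA (rmulC y) rmulA. Qed.

Lemma rmul_joinr x y z : x ⋅ (y `|` z) = x ⋅ y `|` x ⋅ z.
Proof.
apply/le_anti/andP; split.
  by rewrite residuation leUx -!residuation leUl leUr.
by rewrite leUx !residuation; apply/andP; split;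
  [apply: le_trans (leUl y z) _ | apply: le_trans (leUr z y) _];
  rewrite -residuation.
Qed.

Lemma rmul_joinl x y z : (x `|` y) ⋅ z = x ⋅ z `|` y ⋅ z.
Proof. by rewrite rmulC rmul_joinr !(rmulC z). Qed.

Lemma le_rmulr x y z : y <= z -> x ⋅ y <= x ⋅ z.
Proof. by move=> yz; rewrite residuation (le_trans yz) // -residuation. Qed.

Lemma le_rmull x y z : y <= z -> y ⋅ x <= z ⋅ x.
Proof. by rewrite !(rmulC _ x); exact: le_rmulr. Qed.

Lemma rmul_lel x y : x ⋅ y <= x.
Proof. by rewrite -[leRHS]rmulx1 le_rmulr ?lex1. Qed.

Lemma rmul_ler x y : x ⋅ y <= y.
Proof. by rewrite rmulC rmul_lel. Qed.

Lemma rmulx0 x : x ⋅ \bot = \bot.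
Proof. by apply/eqP; rewrite -lex0 rmul_ler. Qed.

Lemma rmul0x x : \bot ⋅ x = \bot.
Proof. by rewrite rmulC rmulx0. Qed.

Lemma rmul_rimp_le x y : x ⋅ (x ⇒ y) <= y.
Proof. by rewrite residuation. Qed.

Lemma rimp_ge x y : y <= x ⇒ y.
Proof. by rewrite -residuation rmul_ler. Qed.

Lemma le_rimpr x y z : y <= z -> x ⇒ y <= x ⇒ z.
Proof. by move=> yz; rewrite -residuation (le_trans (rmul_rimp_le _ _)). Qed.

Lemma le_rneg x y : (y <= rneg x) = (x ⋅ y == \bot).
Proof. by rewrite -residuation lex0. Qed.

Lemma rmulxN x : x ⋅ rneg x = \bot.
Proof. by apply/eqP; rewrite -le_rneg. Qed.

End ResiduatedLattice.

(** * Double negation and disjoint elements in product algebras *)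

Section ProductAlgebra.
Context {d : Order.disp_t} {P : productAlgType d}.
Implicit Types x y z e u w : P.

Lemma rneg_rnegN u : rneg u `|` rneg (rneg u) = \top.
Proof. by have := product_axiom u \bot; rewrite rmulx0. Qed.

(** Multiply z by the Stone identity ¬e ∨ ¬¬e = 1: since z ≤ ¬e, the part z ⋅ ¬¬e vanishes. *)
Lemma rmul_rneg z e : z ⋅ e = \bot -> z ⋅ rneg e = z.
Proof.
move=> ze; rewrite -[RHS]rmulx1 -(rneg_rnegN e) rmul_joinr.
suff -> : z ⋅ rneg (rneg e) = \bot by rewrite joinx0.
apply/eqP; rewrite -lex0 -(rmulxN (rneg e)) le_rmull //.
by rewrite le_rneg rmulC ze.
Qed.

(** Multiplication by ¬e fixes z and kills e. *)
Lemma le_join_disjoint z e x : z ⋅ e = \bot -> z <= x `|` e -> z <= x.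
Proof.
move=> ze zxe; rewrite -(rmul_rneg ze).
apply: le_trans (le_rmull _ zxe) _.
by rewrite rmul_joinl rmulxN joinx0 rmul_lel.
Qed.

(** The right side times z lies below w ∨ e and is disjoint from e, hence lies below w. When e
    witnesses that z is a co-element, this turns a residual out of z into one out of z ∨ e, which is
    in X. *)
Lemma rimp_join_disjoint z e w :
  z ⋅ e = \bot -> (z ⇒ w) = (z `|` e) ⇒ (w `|` e).
Proof.
move=> ze; apply/le_anti/andP; split; rewrite -residuation.
  rewrite rmul_joinl leUx (le_trans (rmul_rimp_le _ _) (leUl _ _)) /=.
  exact: le_trans (rmul_lel _ _) (leUr _ _).
apply: (le_join_disjoint (e := e)); first by rewrite rmulAC ze rmul0x.
by apply: le_trans (le_rmull _ (leUl z e)) (rmul_rimp_le _ _).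
Qed.

Lemma rneg_rneg_term u : rneg (rneg u) = (u ⇒ u ⋅ u) ⇒ u.
Proof.
apply/le_anti/andP; split.
  (* Of the two joinands of the product axiom at (u, u), ¬¬u annihilates the first, ¬u. *)
  rewrite -[leLHS]rmulx1 -(product_axiom u u) rmul_joinr rmulC rmulxN join0x.
  exact: rmul_ler.
rewrite le_rneg -lex0.
(* As ¬u ≤ u ⇒ u ⋅ u, the product of ¬u with the term is below u. Since ¬u is idempotent, a further
   factor ¬u changes nothing and bounds that product by ¬u ⋅ u = 0. *)
have le_u : rneg u ⋅ ((u ⇒ u ⋅ u) ⇒ u) <= u.
  by rewrite (le_trans (le_rmull _ _) (rmul_rimp_le (u ⇒ u ⋅ u) _)) ?le_rimpr.
rewrite -(rmulxN u) -[in leRHS](rmulC (rneg u)).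
have {1}<- : rneg u ⋅ rneg u = rneg u.
  by rewrite rmul_rneg // rmulC rmulxN.
by rewrite -rmulA le_rmulr.
Qed.

End ProductAlgebra.

(** * Co-elements of a subreduct and their closure properties *)

Section Extension.
Context {d : Order.disp_t} {P : productAlgType d} (X : set P).
Implicit Types (x y z e w : P) (u v : P *p bool).
Hypothesis subX : subreduct X.

Let X1 : X \top. Proof. by case: subX. Qed.
Let XM x y : X x -> X y -> X (x ⋅ y).
Proof. by case: subX => ? h *; exact: h. Qed.
Let XR x y : X x -> X y -> X (x ⇒ y).
Proof. by case: subX => ?? h *; exact: h. Qed.
Let XU x y : X x -> X y -> X (x `|` y).
Proof. by case: subX => ???? h *; exact: h. Qed.

Let XNN x : X x -> X (rneg (rneg x)).
Proof.
by move=> Xx; rewrite rneg_rneg_term; do !apply: XR => //; exact: XM.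
Qed.

(** The elements e and z ∨ e of X determine z as (z ∨ e) ⋅ ¬e, although ¬e may lie outside X. *)
Definition codisjoint e z := [/\ X e, z ⋅ e = \bot & X (z `|` e)].

Definition coelement : set P := [set z | exists e, codisjoint e z].

(** Witnesses can be shrunk, so two co-elements share the product of theirs. The element e ⇒ e ⋅ e'
    of X stands in for ¬e: it lies above ¬e, hence fixes z, and it sends e below e ⋅ e'. *)
Lemma codisjoint_rmul z e e' : codisjoint e z -> X e' -> codisjoint (e ⋅ e') z.
Proof.
move=> [Xe ze Xze] Xe'; split; [exact: XM | by rewrite rmulA ze rmul0x |].
suff -> : z `|` e ⋅ e' = (z `|` e) ⋅ (e ⇒ e ⋅ e') `|` e ⋅ e'.
  exact: XU (XM Xze (XR Xe (XM Xe Xe'))) (XM Xe Xe').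
apply/le_anti/andP; split; rewrite leUx leUr andbT rmul_joinl.
  apply: le_trans _ (leUl _ _); apply: le_trans _ (leUl _ _).
  by rewrite -[leLHS](rmul_rneg ze) le_rmulr // le_rimpr // le0x.
by rewrite leU2 ?rmul_lel ?rmul_rimp_le.
Qed.

Lemma coelement_pair z z' : coelement z -> coelement z' ->
  exists e, codisjoint e z /\ codisjoint e z'.
Proof.
move=> [e ez] [e' ez']; exists (e ⋅ e'); split.
  by apply: codisjoint_rmul => //; case: ez'.
by rewrite rmulC; apply: codisjoint_rmul => //; case: ez.
Qed.

Lemma coelement0 : coelement \bot.
Proof. by exists \top; split; rewrite ?rmul0x ?join0x. Qed.

Lemma coelementM z x : coelement z -> X x -> coelement (z ⋅ x).
Proof.
move=> [e [Xe ze Xze]] Xx; exists e; split=> //.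
  by rewrite rmulAC ze rmul0x.
suff -> : z ⋅ x `|` e = (z `|` e) ⋅ x `|` e by exact: XU (XM Xze Xx) Xe.
by rewrite rmul_joinl -joinA (join_idPr (rmul_lel e x)).
Qed.

Lemma coelementMM z z' : coelement z -> coelement z' -> coelement (z ⋅ z').
Proof.
move=> Zz /(coelement_pair Zz) [e [[Xe ze Xze] [_ ze' Xze']]].
exists e; split=> //.
  by rewrite -rmulA ze' rmulx0.
suff -> : z ⋅ z' `|` e = (z `|` e) ⋅ (z' `|` e) `|` e.
  exact: XU (XM Xze Xze') Xe.
rewrite rmul_joinl rmul_joinr ze joinx0 -joinA.
by rewrite (join_idPr (rmul_lel e _)).
Qed.

Lemma coelementU z z' : coelement z -> coelement z' -> coelement (z `|` z').
Proof.
move=> Zz /(coelement_pair Zz) [e [[Xe ze Xze] [_ ze' Xze']]].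
exists e; split=> //.
  by rewrite rmul_joinl ze ze' joinxx.
suff -> : z `|` z' `|` e = (z `|` e) `|` (z' `|` e) by exact: XU.
by rewrite joinACA joinxx.
Qed.

(** In the factor 2 a residual out of 0 is 1, so residuals out of co-elements have to land in X. *)
Lemma coelement_rimp z x : coelement z -> X x -> X (z ⇒ x).
Proof.
by move=> [e [Xe ze Xze]] Xx; rewrite (rimp_join_disjoint _ ze); exact/XR/XU.
Qed.

Lemma coelement_rimp_coelement z z' : coelement z -> coelement z' -> X (z ⇒ z').
Proof.
move=> Zz /(coelement_pair Zz) [e [[Xe ze Xze] [_ _ Xze']]].
by rewrite (rimp_join_disjoint _ ze); exact: XR.
Qed.

(* In a chain x ⇒ z can be nonzero either because z is, so that e = 0, or
   because x = 0; the witness ¬¬(x ⋅ e) vanishes in both cases. *)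
Lemma rimp_coelement x z : X x -> coelement z -> coelement (x ⇒ z).
Proof.
move=> Xx [e [Xe ze Xze]]; exists (rneg (rneg (x ⋅ e))).
have xz_neg : x ⇒ z <= rneg (x ⋅ e).
  by rewrite le_rneg -lex0 -ze rmulAC le_rmull // rmul_rimp_le.
split; first exact/XNN/XM.
  by apply/eqP; rewrite -lex0 -(rmulxN (rneg (x ⋅ e))) le_rmull.
suff -> : (x ⇒ z) `|` rneg (rneg (x ⋅ e)) =
    (x ⇒ z `|` e) `|` rneg (rneg (x ⋅ e)).
  exact: XU (XR Xx Xze) (XNN (XM Xx Xe)).
apply/le_anti/andP; split; rewrite leUx leUr andbT.
  exact: le_trans (le_rimpr x (leUl z e)) (leUl _ _).
(* Split along ¬(x ⋅ e) ∨ ¬¬(x ⋅ e). On the first part, x ⋅ (x ⇒ z ∨ e) ⋅ ¬(x ⋅ e) is disjoint from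
   e and below z ∨ e, hence below z. *)
rewrite -[leLHS]rmulx1 -(rneg_rnegN (x ⋅ e)) rmul_joinr leU2 ?rmul_ler //.
rewrite -residuation; apply: (le_join_disjoint (e := e)).
  rewrite rmulA (rmulAC _ (rneg _)) (rmulAC x) (rmulAC _ _ (rneg _)).
  by rewrite rmulxN rmul0x.
by rewrite rmulA (le_trans (rmul_lel _ _)) // rmul_rimp_le.
Qed.

(** Here e ⇒ x stands in for ¬e: it fixes z and sends e below x, where the join with x absorbs
    it. *)
Lemma coelement_join z x : coelement z -> X x -> X (x `|` z).
Proof.
move=> [e [Xe ze Xze]] Xx.
suff -> : x `|` z = x `|` (z `|` e) ⋅ (e ⇒ x) by exact/XU/XM/XR.
apply/le_anti/andP; split; rewrite leUx leUl rmul_joinl /=.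
  rewrite joinA lexU2 // (le_trans _ (leUr _ _)) //.
  by rewrite -[leLHS](rmul_rneg ze) le_rmulr // le_rimpr // le0x.
by rewrite joinC leU2 ?rmul_lel ?rmul_rimp_le.
Qed.

(** * The subalgebra of P × 2 and its product algebra structure *)

Definition extension_mem (u : P *p bool) : bool :=
  if u.2 then `[< X u.1 >] else `[< coelement u.1 >].

Lemma extension_memP (p : P) (b : bool) :
  reflect (if b then X p else coelement p)
    (((p, b) : P *p bool) \in extension_mem).
Proof. by rewrite /in_mem /= /extension_mem /=; case: b; exact: asboolP. Qed.

Definition pair_mul (u v : P *p bool) : P *p bool := (u.1 ⋅ v.1, u.2 && v.2).
Definition pair_imp (u v : P *p bool) : P *p bool := (u.1 ⇒ v.1, u.2 ==> v.2).

Lemma extension_mul u v :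
  u \in extension_mem -> v \in extension_mem -> pair_mul u v \in extension_mem.
Proof.
case: u v => [p [|]] [q [|]] /extension_memP Hp /extension_memP Hq;
  apply/extension_memP => /=.
- exact: XM.
- by rewrite rmulC; exact: coelementM.
- exact: coelementM.
- exact: coelementMM.
Qed.

Lemma extension_imp u v :
  u \in extension_mem -> v \in extension_mem -> pair_imp u v \in extension_mem.
Proof.
case: u v => [p [|]] [q [|]] /extension_memP Hp /extension_memP Hq;
  apply/extension_memP => /=.
- exact: XR.
- exact: rimp_coelement.
- exact: coelement_rimp.
- exact: coelement_rimp_coelement.
Qed.

(** Divisibility in both factors reduces closure under meets to closure under ⋅ and ⇒. *)
Lemma pair_meetE u v : u `&` v = pair_mul u (pair_imp u v).
Proof.
case: u v => [p b] [q c].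
rewrite Order.ProdOrder.meetEprod /pair_mul /= divisibility.
by case: b c => [] [].
Qed.

Lemma extension_meet : meet_closed extension_mem.
Proof.
by move=> u v Hu Hv; rewrite pair_meetE extension_mul ?extension_imp.
Qed.

Lemma extension_join : join_closed extension_mem.
Proof.
case=> [p [|]] [q [|]] /extension_memP Hp /extension_memP Hq;
  apply/extension_memP => /=.
- exact: XU.
- exact: coelement_join.
- by rewrite joinC; exact: coelement_join.
- exact: coelementU.
Qed.

Lemma extension_bot : \bot \in extension_mem.
Proof. exact/extension_memP/coelement0. Qed.

Lemma extension_top : \top \in extension_mem.
Proof. exact/extension_memP. Qed.

(* The proof is an argument of the type so that the structures below, which
   depend on it, can be inferred. *)
Definition extension (_ : subreduct X) : Type :=
  {u : P *p bool | extension_mem u}.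
Local Notation E := (extension subX).

HB.instance Definition _ := SubChoice.on E.
HB.instance Definition _ := Order.SubChoice_isTBSubLattice.Build _ _
  extension_mem d E extension_meet extension_join
  extension_bot extension_top.

Implicit Types a b c : E.

Let valI a b : val (a `&` b) = val a `&` val b. Proof. by []. Qed.
Let valU a b : val (a `|` b) = val a `|` val b. Proof. by []. Qed.

Definition ext_mul a b : E :=
  Sub (pair_mul (val a) (val b)) (extension_mul (valP a) (valP b)).
Definition ext_imp a b : E :=
  Sub (pair_imp (val a) (val b)) (extension_imp (valP a) (valP b)).

Lemma ext_mulA : associative ext_mul.
Proof. by move=> a b c; apply: val_inj; rewrite /= /pair_mul rmulA andbA. Qed.

Lemma ext_mulC : commutative ext_mul.
Proof. by move=> a b; apply: val_inj; rewrite /= /pair_mul rmulC andbC. Qed.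

Lemma ext_mul1x : left_id \top ext_mul.
Proof.
by move=> a; apply: val_inj; rewrite /= /pair_mul /= rmul1x; case: (val a).
Qed.

Lemma ext_residuation a b c : (ext_mul a b <= c) = (b <= ext_imp a c).
Proof.
rewrite -!Order.le_val !Order.ProdOrder.leEprod /= residuation.
by case: (val a) (val b) (val c) => [? []] [? []] [? []].
Qed.

HB.instance Definition _ := TBLattice_isBCIRL.Build d E
  ext_mulA ext_mulC ext_mul1x ext_residuation.

Lemma ext_divisibility a b : a `&` b = a ⋅ (a ⇒ b).
Proof. by apply: val_inj; rewrite valI pair_meetE. Qed.

Lemma ext_prelinearity a b : (a ⇒ b) `|` (b ⇒ a) = \top.
Proof.
apply: val_inj; rewrite valU /= Order.ProdOrder.joinEprod /= prelinearity.
by case: (val a) (val b) => [? []] [? []].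
Qed.

HB.instance Definition _ :=
  BCIRL_isBL.Build d E ext_divisibility ext_prelinearity.

Lemma ext_product_axiom a b : rneg a `|` ((a ⇒ a ⋅ b) ⇒ b) = \top.
Proof.
apply: val_inj; rewrite valU /= Order.ProdOrder.joinEprod /= product_axiom.
by case: (val a) (val b) => [? []] [? []].
Qed.

HB.instance Definition _ := BL_isProduct.Build d E ext_product_axiom.

(** * The copy of X as a maximal filter *)

Definition ext_filter : set E := [set a : E | (val a).2].

Lemma maximal_ext_filter : maximal_filter ext_filter.
Proof.
split; first split.
- split.
  + by exists \top.
  + by move=> a b; rewrite /ext_filter /= => -> ->.
  + move=> a b; rewrite -Order.le_val Order.ProdOrder.leEprod /ext_filter /mkset.
    by move=> + /andP[_]; case: (val a).2 (val b).2 => [] [].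
- by move=> FE; have : ext_filter \bot by rewrite FE.
case=> G [[_ GM GU] GE] [FG /existsNP[a /not_implyP[Ga Fa]]]; apply: GE.
suff G0 : G \bot by apply/seteqP; split=> // b _; apply: GU G0 (le0x b).
have {}Fa : (val a).2 = false by exact/negP.
(* Outside the filter, [a] is (z, 0) with z a co-element; its witness e gives the filter element (e,
   1), which multiplies [a] to bottom. *)
have [e [Xe pe _]] : coelement (val a).1.
  have : (((val a).1, false) : P *p bool) \in extension_mem.
    by rewrite -Fa -surjective_pairing; exact: valP.
  by move/extension_memP.
have eE : ((e, true) : P *p bool) \in extension_mem by exact/extension_memP.
have -> : \bot = a ⋅ (Sub (e, true) eE : E).
  by apply: val_inj; rewrite /= /pair_mul Fa pe.
by apply: GM => //; exact: FG.
Qed.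

Lemma isomorphic_ext_filter (S : hoopAlg) :
  isomorphic_to_sub S X -> isomorphic_to_sub S ext_filter.
Proof.
case=> f [[fX f_inj f_surj] fM fR fI [fU f1]].
have fE s : (f s, true) \in extension_mem by apply/extension_memP/fX.
exists (fun s => Sub (f s, true) (fE s)); split; [split|..|split].
- by [].
- by move=> s t sS tS [/f_inj]; exact.
- case=> [[p [|]] pE] //= _; have /extension_memP Xp := pE.
  have [s _ fs] := f_surj _ Xp; exists s => //.
  by apply: val_inj; rewrite /= fs.
- by move=> s t; apply: val_inj; rewrite /= fM.
- by move=> s t; apply: val_inj; rewrite /= fR.
- by move=> s t; apply: val_inj; rewrite /= fI.
- by move=> s t; apply: val_inj; rewrite /= fU.
- by apply: val_inj; rewrite /= f1.
Qed.

End Extension.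

(** * Filters are subreducts, and the equivalence *)

Lemma filter_subreduct (d : Order.disp_t) (P : bcirlType d) (F : set P) :
  is_filter F -> subreduct F.
Proof.
case=> -[x Fx] FM FU; split=> [|y z Fy Fz|y z Fy Fz|y z Fy Fz|y z Fy Fz].
- exact: FU Fx (lex1 x).
- exact: FM.
- exact: FU Fz (rimp_ge y z).
- by apply: FU (FM _ _ Fy Fz) _; rewrite lexI rmul_lel rmul_ler.
- exact: FU Fy (leUl y z).
Qed.

Theorem corollary3p4 (S : hoopAlg) :
  product_hoop S <->
  exists (d : Order.disp_t) (P : productAlgType d) (F : set P),
    maximal_filter F /\ isomorphic_to_sub S F.
Proof.
split=> [[d [P [X [subX SX]]]]|[d [P [F [[[filF _] _] SF]]]]].
  exists d, (extension subX), (@ext_filter _ _ _ subX); split.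
    exact: maximal_ext_filter.
  exact: isomorphic_ext_filter.
by exists d, P, F; split=> //; exact: filter_subreduct.
Qed.
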